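(* The shifted Heller constant satisfies $\widehat{h}(m) = O(m^3)$; that is, there exists an absolute constant $C > 0$ such that $\widehat{h}(m) \le C\, m^3$ for every integer $m \ge 1$.
   Context: For a real matrix $M$ with $m$ rows and $n$ columns and $1 \le k \le \min(m,n)$, let $\Delta_k(M)$ denote the maximum of the absolute values of the determinants of all $k \times k$ submatrices of $M$. The matrix $M$ is called totally $1$-submodular if $\max_k \Delta_k(M) \le 1$, i.e. every square submatrix of every order has determinant of absolute value at most $1$. For a vector $t \in \mathbb{R}^m$ and a matrix $A \in \mathbb{R}^{m \times n}$, $t + A$ denotes the matrix obtained by adding $t$ to every column of $A$. The shifted Heller constant $\widehat{h}(m)$ is the maximal number $n$ such that there exist a nonzero translation vector $t \in [0,1)^m$ and a matrix $A \in \{-1,0,1\}^{m \times n}$ with pairwise distinct columns such that $t + A$ is totally $1$-submodular. *)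

(* Defs.v *)
From HB Require Import structures.
From mathcomp Require Import all_boot all_order all_algebra.
From mathcomp Require Import boolp reals.

Set Implicit Arguments.
Unset Strict Implicit.
Unset Printing Implicit Defensive.

Import Order.TTheory GRing.Theory Num.Theory.
Local Open Scope ring_scope.

(* Strictly increasing selections, so that [mxsub f g M] is the submatrix on
   the row set [codom f] and the column set [codom g], in the original order. *)
Definition increasing_sel (k m : nat) (f : {ffun 'I_k -> 'I_m}) : bool :=
  [forall i : 'I_k, forall j : 'I_k, (i < j)%N ==> (f i < f j)%N].

(* The neutral element 0 is harmless: absolute values are nonnegative. *)
Definition Delta (R : realType) (m n : nat) (k : nat) (M : 'M[R]_(m, n)) : R :=
  \big[Num.max/0 : R]_(f : {ffun 'I_k -> 'I_m} | increasing_sel f)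
    \big[Num.max/0 : R]_(g : {ffun 'I_k -> 'I_n} | increasing_sel g)
      `|\det (mxsub f g M)|.

Definition totally_1_submodular (R : realType) (m n : nat)
    (M : 'M[R]_(m, n)) : bool :=
  \big[Num.max/0 : R]_(1 <= k < (minn m n).+1) Delta k M <= 1.

Definition shift_mx (R : realType) (m n : nat)
    (t : 'cV[R]_m) (A : 'M[R]_(m, n)) : 'M[R]_(m, n) :=
  \matrix_(i < m, j < n) (t i 0 + A i j).

Definition shifted_heller_admissible (R : realType) (m n : nat) : Prop :=
  exists (t : 'cV[R]_m) (A : 'M[R]_(m, n)),
    [/\ t != 0,
        forall i, 0 <= t i 0 < 1,
        forall i j, A i j \in [:: -1; 0; 1],
        injective (fun j => col j A)
      & totally_1_submodular (shift_mx t A)].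

(* Pairwise distinct columns in {-1,0,1}^m force n <= 3 ^ m, so the range of
   the maximum below loses nothing; [shifted_hellerP] shows that it is the
   genuine maximum for m >= 1. For m = 0 there is no nonzero t and the value
   is the conventional 0. *)
Definition shifted_heller (R : realType) (m : nat) : nat :=
  \max_(n < (3 ^ m).+1 | `[< shifted_heller_admissible R m n >]) n.

Lemma shifted_heller_admissible_ub (R : realType) (m n : nat) :
  shifted_heller_admissible R m n -> (n <= 3 ^ m)%N.
Proof.
move=> [t [A [_ _ A3 Ainj _]]].
pose c j : {ffun 'I_m -> 'I_3} :=
  [ffun i => inord (index (A i j) [:: -1; 0; 1])].
have /leq_card : injective c.
  move=> j1 j2 /ffunP cE; apply: Ainj; apply/colP => i; rewrite !mxE.
  have lt3 j : (index (A i j) [:: -1; 0; 1]%R < 3)%N by rewrite index_mem.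
  have := cE i; rewrite !ffunE => /(congr1 (@nat_of_ord 3)).
  rewrite !inordK // => /(congr1 (nth 0 [:: -1; 0; 1 : R])).
  by rewrite !nth_index.
by rewrite card_ffun !card_ord.
Qed.

Lemma shifted_heller_admissible0 (R : realType) (m : nat) :
  (0 < m)%N -> shifted_heller_admissible R m 0.
Proof.
case: m => // m _; exists (const_mx 2^-1), 0; split.
- apply/eqP => /matrixP/(_ 0 0); rewrite !mxE => /eqP.
  by rewrite invr_eq0 pnatr_eq0.
- by move=> i; rewrite mxE invr_ge0 ler0n invf_lt1 ?ltr0n ?ltr1n.
- by move=> i [].
- by case.
- by rewrite /totally_1_submodular minn0 big_nil.
Qed.

Lemma shifted_hellerP (R : realType) (m : nat) : (0 < m)%N ->
  shifted_heller_admissible R m (shifted_heller R m) /\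
  (forall n, shifted_heller_admissible R m n -> (n <= shifted_heller R m)%N).
Proof.
move=> m0; split.
  have a0 : `[< shifted_heller_admissible R m (ord0 : 'I_(3 ^ m).+1) >].
    by apply/asboolP; exact: shifted_heller_admissible0.
  rewrite /shifted_heller (bigop.bigmax_eq_arg ord0) //.
  by case: arg_maxnP => // i /asboolP.
move=> n nP; have nlt : (n < (3 ^ m).+1)%N.
  by rewrite ltnS; exact: shifted_heller_admissible_ub nP.
apply: (@leq_bigmax_cond _ _ _ (Ordinal nlt)).
by apply/asboolP.
Qed.

(* Main.v *)
Require Import Defs.
From HB Require Import structures.
From mathcomp Require Import all_boot all_order all_algebra all_fingroup.
From mathcomp Require Import boolp reals.
From mathcomp Require Import ring lra zify.

Set Implicit Arguments.
Unset Strict Implicit.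
Unset Printing Implicit Defensive.

Import Order.TTheory GRing.Theory Num.Theory.
Local Open Scope ring_scope.

(** The columns of the matrix are regarded as a duplicate-free list of vectors
    all of whose minors, on any choice of rows and columns, are bounded by 1.
    Write t for the shift. Rows fall into three kinds.

    If t_p is neither 0 nor 1/2, then row p takes only the values t_p and
    t_p - 1, and one of them, c, has absolute value greater than 1/2. Among the
    columns with entry c in row p, differences with a fixed column v0 are
    integral, and every minor of the differences, multiplied by c, is a minor of
    the original family (pivot on the entry c). So these minors are integers
    smaller than 2 in absolute value: the differences are totally unimodular, and
    Heller's theorem bounds their number quadratically ([size_constant_row]).
    Over all such p this accounts for O(m^3) columns. The remaining columns take
    the other value in each of these rows, hence are told apart by the rows with
    t_p = 0, whose entries are integers, and those with t_p = 1/2, whose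
    entries are 1/2 or -1/2.

    The rows with t_p = 1/2 are deleted one at a time ([half_rows]), keeping one
    column out of each pair that becomes equal. The columns lost by a deletion
    are those u that occur with both values of row p ([fiber]), so
    the entries of row p can be chosen freely over them. Take a nonzero minor B
    of the largest possible order among them; a column is then determined by its
    coordinate vector x = B^-1 u ([coords_inj]). Adjoining row p and the column u
    to B gives the minor det B * (y0 - y x), and varying the freely chosen entries
    y0, y turns the bound on minors into |det B| * (1 + sum |x_j|) <= 2
    ([free_row_l1]). All minors lie in {0, 1/2, 1} up to sign. If B can be chosen
    with |det B| = 1, then x is a half-integral vector of l1 norm at most 1, which
    leaves O(m^2) possibilities. Otherwise all nonzero minors of maximal order are
    1/2 up to sign, the vectors x form a totally unimodular family, and Heller's
    theorem applies again ([half_modular_fiber]). So each deletion costs O(m^2)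
    columns.

    Heller's theorem itself ([heller]) follows from the same argument: with
    minors in {0, 1} the vector x is integral of l1 norm at most 1, so deleting
    a row costs only O(m) columns. *)

(** * Minors of a family of vectors *)

Definition minor_mx (R : realType) m k (f : 'I_k -> 'I_m)
    (v : 'I_k -> 'cV[R]_m) : 'M[R]_k := \matrix_(i, j) v j (f i) 0.

Definition minor (R : realType) m k (f : 'I_k -> 'I_m)
    (v : 'I_k -> 'cV[R]_m) : R := \det (minor_mx f v).

(** Appends a row index or a column. The shape ['I_(k + 1)] is the one on which
    block matrices split. *)
Definition snoc X k (f : 'I_k -> X) (x : X) : 'I_(k + 1) -> X :=
  fun i => if split i is inl j then f j else x.

Definition coords (R : realType) m k (f : 'I_k -> 'I_m)
    (b : 'I_k -> 'cV[R]_m) (d : 'cV[R]_m) : 'cV[R]_k :=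
  invmx (minor_mx f b) *m \col_i d (f i) 0.

(** Rows and columns are selected by arbitrary functions: repetitions only add
    vanishing minors, and reorderings change only the sign. *)
Definition minors_in (R : realType) m (T : {set 'I_m}) (V : seq 'cV[R]_m)
    (P : R -> Prop) : Prop :=
  forall k (f : 'I_k -> 'I_m) (v : 'I_k -> 'cV[R]_m),
    (forall i, f i \in T) -> (forall j, v j \in V) -> P `|minor f v|.

Lemma snoc_all X k (f : 'I_k -> X) x (P : X -> Prop) :
  (forall i, P (f i)) -> P x -> forall i, P (snoc f x i).
Proof. by move=> Pf Px i; rewrite /snoc; case: split. Qed.

Lemma minor_not_inj (R : realType) m k (f : 'I_k -> 'I_m)
  (v : 'I_k -> 'cV[R]_m) : ~ injective f -> minor f v = 0.
Proof.
move=> /injectiveP/injectivePn[i [j nij fij]].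
apply: (determinant_alternate nij) => l.
by rewrite !mxE fij.
Qed.

Lemma minor_nz_inj (R : realType) m k (f : 'I_k -> 'I_m)
  (v : 'I_k -> 'cV[R]_m) : minor f v != 0 -> injective f.
Proof.
move=> nz; case: (pselect (injective f)) => // ninj.
by rewrite minor_not_inj ?eqxx in nz.
Qed.

Lemma minor_mx_snoc (R : realType) m k (f : 'I_k -> 'I_m)
    (v : 'I_k -> 'cV[R]_m) p d :
  minor_mx (snoc f p) (snoc v d) =
  block_mx (minor_mx f v) (\col_i d (f i) 0) (\row_j v j p 0) (d p 0)%:M.
Proof.
apply/matrixP => i j; rewrite !mxE /snoc.
case: (split i) => i'; rewrite !mxE; case: (split j) => j'; rewrite !mxE //.
by rewrite !ord1.
Qed.

(** The Schur complement formula. Writing the off-diagonal block as a product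
    avoids any invertibility hypothesis. *)
Lemma det_schur_right (R : comNzRingType) k l (A : 'M[R]_k) (x : 'M[R]_(k, l))
    (c : 'M[R]_(l, k)) (d : 'M[R]_l) :
  \det (block_mx A (A *m x) c d) = \det A * \det (d - c *m x).
Proof.
have -> : block_mx A (A *m x) c d =
    block_mx A 0 c (d - c *m x) *m block_mx 1%:M x 0 1%:M.
  by rewrite mulmx_block !mulmx1 !mul0mx !mulmx0 !addr0 addrC subrK.
by rewrite det_mulmx det_lblock det_ublock !det1 !mulr1.
Qed.

Lemma det_schur_left (R : comNzRingType) k l (A : 'M[R]_k) (b : 'M[R]_(k, l))
    (y : 'M[R]_(l, k)) (d : 'M[R]_l) :
  \det (block_mx A b (d *m y) d) = \det (A - b *m y) * \det d.
Proof.
have -> : block_mx A b (d *m y) d =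
    block_mx (A - b *m y) b 0 d *m block_mx 1%:M 0 y 1%:M.
  by rewrite mulmx_block !mulmx1 !mul0mx !mulmx0 !add0r subrK.
by rewrite det_mulmx det_lblock det_ublock !det1 !mulr1.
Qed.

Section Coordinates.
Variables (R : realType) (m k : nat) (f : 'I_k -> 'I_m) (b : 'I_k -> 'cV[R]_m).
Hypothesis nz : minor f b != 0.

Let unitB : minor_mx f b \in unitmx.
Proof. by rewrite unitmxE unitfE. Qed.

Lemma coordsK d : minor_mx f b *m coords f b d = \col_i d (f i) 0.
Proof. by rewrite mulKVmx. Qed.

Lemma coords_basis r : coords f b (b r) = delta_mx r 0.
Proof.
apply: (canLR (mulKmx unitB)); apply/colP => i; rewrite !mxE (bigD1 r) //=.
by rewrite big1 ?mxE ?eqxx ?mulr1 ?addr0 // => j nj; rewrite !mxE (negPf nj) mulr0.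
Qed.

Lemma minor_snoc_coords p d :
  minor (snoc f p) (snoc b d) =
  minor f b * (d p 0 - \sum_j b j p 0 * coords f b d j 0).
Proof.
rewrite /minor minor_mx_snoc -coordsK det_schur_right; congr (_ * _).
rewrite det_mx11 !mxE eqxx mulr1n; congr (_ - _).
by apply: eq_bigr => j _; rewrite mxE.
Qed.

(** Up to the factor [minor f b], the minors of the coordinate vectors are minors
    of maximal order of the original family. A minor of order less than [k] can
    be enlarged without changing its value: the basis vector [b r] has
    coordinates [delta_mx r 0], so adjoining it together with an unused row
    [r] gives a block triangular matrix. At order [k] the coordinate matrix is
    the product of an inverse and a minor, up to a permutation of the rows. *)
Lemma minor_coords (T : {set 'I_m}) (U : seq 'cV[R]_m) :
    (forall i, f i \in T) -> (forall j, b j \in U) ->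
  forall l (g : 'I_l -> 'I_k) (v : 'I_l -> 'cV[R]_m),
    injective g -> (forall j, v j \in U) ->
  exists f' : 'I_k -> 'I_m, exists v' : 'I_k -> 'cV[R]_m,
  [/\ forall i, f' i \in T, forall j, v' j \in U &
      `|minor g (fun j => coords f b (v j))| * `|minor f b| = `|minor f' v'|].
Proof.
move=> fT bU l g v gI vU.
have lk : (l <= k)%N by rewrite -[l]card_ord -[k]card_ord (leq_card g).
have [n] : exists n, (l + n)%N = k by exists (k - l)%N; rewrite subnKC.
elim: n l g v gI vU {lk} => [|n IH] l g v gI vU lnk.
  rewrite addn0 in lnk; subst l; exists f, v; split=> //.
  have e : minor_mx g (fun j => coords f b (v j)) =
      row_perm (perm gI) (invmx (minor_mx f b) *m minor_mx f v).
    apply/matrixP => i j; rewrite !mxE permE; apply: eq_bigr => h _.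
    by rewrite !mxE.
  rewrite /minor e row_permE !det_mulmx det_perm !normrM normr_sign mul1r det_inv.
  by rewrite normrV ?unitfE // mulrAC mulVf ?mul1r // normr_eq0.
have [r rg] : exists r, r \notin codom g.
  apply/existsP; rewrite -negb_forall; apply/negP => /forallP gs.
  have := card_codom gI; rewrite card_ord => e.
  have : (k <= l)%N by rewrite -e -{1}[k]card_ord; apply/subset_leq_card/subsetP.
  by rewrite -lnk -{2}[l]addn0 leq_add2l.
have [|||f' [v' [f'T v'U e]]] := IH (l + 1)%N (snoc g r) (snoc v (b r)).
- move=> i j; rewrite /snoc; case: (splitP i) => i' ei; case: (splitP j) => j' ej.
  + by move/gI => e; apply: val_inj; rewrite /= ei ej e.
  + by move=> e; case/negP: rg; rewrite -e codom_f.
  + by move=> e; case/negP: rg; rewrite e codom_f.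
  + by move=> _; apply: val_inj; rewrite /= ei ej !ord1.
- exact: (@snoc_all _ _ v (b r) (fun u => u \in U)).
- by rewrite -addnA add1n.
exists f', v'; split=> //; rewrite -e; congr (_ * _); congr `|_|.
have snocE : (fun j => coords f b (snoc v (b r) j)) =
    snoc (fun j => coords f b (v j)) (delta_mx r 0).
  by apply: funext => j; rewrite /snoc; case: split => //= _; rewrite coords_basis.
rewrite snocE.
rewrite /minor minor_mx_snoc (_ : \col_i _ = 0); last first.
  apply/colP => i; rewrite !mxE (_ : g i == r = false) //.
  by apply/negbTE; apply: contraNneq rg => <-; apply: codom_f.
by rewrite det_lblock det_mx11 !mxE !eqxx !mulr1.
Qed.

End Coordinates.

(** * Coordinates in a nonzero minor of maximal order *)

Definition nonzero_minor (R : realType) m (T : {set 'I_m}) (U : seq 'cV[R]_m) k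
    (f : 'I_k -> 'I_m) (b : 'I_k -> 'cV[R]_m) : Prop :=
  [/\ forall i, f i \in T, forall j, b j \in U & minor f b != 0].

Definition separates (R : realType) m (T : {set 'I_m}) (V : seq 'cV[R]_m) :=
  {in V &, forall v w : 'cV[R]_m, (forall i, i \in T -> v i 0 = w i 0) -> v = w}.

Lemma maximal_minor_order (R : realType) m (T : {set 'I_m}) (U : seq 'cV[R]_m) :
  exists k, [/\ (k <= m)%N,
    exists f b, @nonzero_minor R m T U k f b &
    forall f b, ~ @nonzero_minor R m T U (k + 1) f b].
Proof.
pose Q k := `[< exists f b, @nonzero_minor R m T U k f b >].
have Q0 : exists k, Q k.
  exists 0%N; apply/asboolP.
  exists (fun i : 'I_0 => False_rect _ (notF (ltn_ord i))), (fun=> 0); split.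
  - by case.
  - by case.
  - by rewrite /minor det_mx00 oner_neq0.
have Qm k : Q k -> (k <= m)%N.
  move=> /asboolP[f [b [_ _ /minor_nz_inj fI]]].
  by rewrite -[k]card_ord -[m]card_ord (leq_card f).
case: (ex_maxnP Q0 Qm) => k /[dup] Qk /asboolP ex max.
exists k; split=> // [|f b fb]; first exact: Qm.
suff /max : Q (k + 1)%N by rewrite addn1 ltnn.
by apply/asboolP; exists f, b.
Qed.

(** By maximality, adjoining the vector [d] and any row [i] in [T] makes the minor
    vanish, which expresses the entry of [d] in row [i] through its coordinates. *)
Lemma coords_inj (R : realType) m (T : {set 'I_m}) (U : seq 'cV[R]_m) k f b :
    @nonzero_minor R m T U k f b ->
    (forall f b, ~ @nonzero_minor R m T U (k + 1) f b) ->
  separates T U -> {in U &, injective (coords f b)}.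
Proof.
move=> [fT bU nz] max sepU.
have rowE d i : d \in U -> i \in T ->
    d i 0 = \sum_j b j i 0 * coords f b d j 0.
  move=> dU iT; apply/eqP; rewrite -subr_eq0; apply: contra_notT (max _ _) => nz'.
  split; [exact: (@snoc_all _ _ f i (fun u => u \in T)) |
    exact: (@snoc_all _ _ b d (fun u => u \in U)) |].
  by rewrite minor_snoc_coords // mulf_neq0.
move=> v w vU wU e; apply: sepU => // i iT.
by rewrite !rowE // e.
Qed.

(** If every vector of [U] extends to [V] with either of the values [a], [c] in
    row [p], then the last row of the minor obtained by adjoining [p] and [d] is
    a free choice of these two values. The difference between the largest and the
    smallest value of such a minor is [minor f b * (1 + \sum_j `|x j|)] up to
    sign, while both are between -1 and 1. *)
Lemma free_row_l1 (R : realType) m (T : {set 'I_m}) p (V U : seq 'cV[R]_m)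
    (a c : R) k (f : 'I_k -> 'I_m) (b : 'I_k -> 'cV[R]_m) d :
    minors_in (p |: T) V (fun x => x <= 1) ->
    (forall u y, u \in U -> y \in [:: a; c] -> exists2 w, w \in V &
       w p 0 = y /\ forall i, i \in T -> w i 0 = u i 0) ->
    a - c = 1 -> nonzero_minor T U f b -> d \in U ->
  `|minor f b| * (1 + \sum_j `|coords f b d j 0|) <= 2.
Proof.
move=> Vle lift ac [fT bU nz] dU.
set x := coords f b d.
have bound (y0 : R) (y : 'I_k -> R) : y0 \in [:: a; c] ->
    (forall j, y j \in [:: a; c]) ->
    `|minor f b| * `|y0 - \sum_j y j * x j 0| <= 1.
  move=> y0ac yac.
  have [w0 w0V [w0p w0T]] := lift d y0 dU y0ac.
  have /choice[w wP] : forall j, exists w, w \in V /\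
      (w p 0 = y j /\ forall i, i \in T -> w i 0 = b j i 0).
    by move=> j; have [w] := lift (b j) (y j) (bU j) (yac j); exists w.
  have wb : minor_mx f w = minor_mx f b.
    by apply/matrixP => i j; rewrite !mxE; have [_ [_ ->]] := wP j.
  have wnz : minor f w != 0 by rewrite /minor wb.
  have xE : coords f w w0 = x.
    by rewrite /coords wb; congr (_ *m _); apply/colP => i; rewrite !mxE w0T.
  have := Vle _ (snoc f p) (snoc w w0).
  rewrite minor_snoc_coords // xE w0p /minor wb normrM => H.
  rewrite (eq_bigr (fun j => w j p 0 * x j 0)); last first.
    by move=> j _; have [_ [-> _]] := wP j.
  apply: H.
  - apply: (@snoc_all _ _ f p (fun u => u \in p |: T)); last by rewrite setU11.
    by move=> i; rewrite setU1r.
  - apply: (@snoc_all _ _ w w0 (fun u => u \in V)) => // j.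
    by have [] := wP j.
(* The two extremal choices: [y1] minimises and [y2] maximises the sum. *)
pose y1 j := if x j 0 <= 0 then a else c.
pose y2 j := if x j 0 <= 0 then c else a.
have b1 : `|minor f b| * `|a - \sum_j y1 j * x j 0| <= 1.
  by apply: bound => [|j]; rewrite /y1 ?inE ?eqxx //; case: ifP; rewrite ?eqxx ?orbT.
have b2 : `|minor f b| * `|c - \sum_j y2 j * x j 0| <= 1.
  by apply: bound => [|j]; rewrite /y2 ?inE ?eqxx ?orbT //; case: ifP; rewrite ?eqxx ?orbT.
have e : \sum_j `|x j 0| = \sum_j y2 j * x j 0 - \sum_j y1 j * x j 0.
  rewrite -sumrB; apply: eq_bigr => j _.
  rewrite /y1 /y2 -mulrBl; case: ifP => xj.
    by rewrite ler0_norm // -opprB ac mulN1r.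
  by rewrite gtr0_norm ?ac ?mul1r // ltNge xj.
have -> : 1 + \sum_j `|x j 0| =
    (a - \sum_j y1 j * x j 0) - (c - \sum_j y2 j * x j 0).
  by rewrite e; lra.
rewrite mulrBr; have := ler_norm (`|minor f b| * (a - \sum_j y1 j * x j 0)).
have := ler_norm (- (`|minor f b| * (c - \sum_j y2 j * x j 0))).
rewrite normrN !normrM normr_id => h1 h2.
lra.
Qed.

(** * Short integral and half-integral vectors *)

Definition signed_units (R : realType) k : seq 'cV[R]_k :=
  0 :: [seq delta_mx j 0 | j <- enum 'I_k] ++ [seq - delta_mx j 0 | j <- enum 'I_k].

Lemma size_signed_units (R : realType) k : size (signed_units R k) = (2 * k).+1.
Proof. by rewrite /= size_cat !size_map -enumT size_enum_ord addnn -mul2n. Qed.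

Lemma l1_split (R : realType) k (x : 'cV[R]_k) j :
  \sum_i `|x i 0| = `|x j 0| + \sum_i `|(x - x j 0 *: delta_mx j 0) i 0|.
Proof.
rewrite (bigD1 j) //= [in RHS](bigD1 j) //= !mxE !eqxx mulr1 subrr normr0 add0r.
congr (_ + _); apply: eq_bigr => i nij.
by rewrite !mxE (negPf nij) mulr0 subr0.
Qed.

Lemma l1_eq0 (R : realType) k (x : 'cV[R]_k) : \sum_i `|x i 0| <= 0 -> x = 0.
Proof.
move=> x0; apply/colP => i; rewrite mxE; apply/eqP; rewrite -normr_le0.
apply: le_trans x0; rewrite (bigD1 i) //= lerDl sumr_ge0 //.
Qed.

Lemma signed_unitsE (R : realType) k j (s : R) : `|s| = 1 ->
  s *: delta_mx j 0 \in signed_units R k.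
Proof.
move=> s1; rewrite inE mem_cat; apply/orP; right; apply/orP.
have [s0|s0] := leP 0 s; [left | right]; apply/mapP; exists j; rewrite ?mem_enum //.
  by move: s1; rewrite ger0_norm // => ->; rewrite scale1r.
by move: s1; rewrite ltr0_norm // => /(canRL opprK) ->; rewrite scaleN1r.
Qed.

Lemma col_neq0P (R : realType) k (x : 'cV[R]_k) :
  x != 0 -> exists j, x j 0 != 0.
Proof.
apply: contra_neqP => /forallNP x0; apply/colP => j; rewrite mxE.
by apply/eqP/negPn/negP/x0.
Qed.

Lemma l1_le1_integer (R : realType) k (x : 'cV[R]_k) :
    (forall j, `|x j 0| \in [:: 0; 1]) -> \sum_j `|x j 0| <= 1 ->
  x \in signed_units R k.
Proof.
move=> x01 xle; have [->|] := eqVneq x 0; first by rewrite inE eqxx.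
move=> /col_neq0P[j xj].
have xj1 : `|x j 0| = 1.
  by move: (x01 j); rewrite !inE normr_eq0 (negPf xj) => /eqP.
(* One entry already exhausts the norm, so all others vanish. *)
rewrite (_ : x = x j 0 *: delta_mx j 0); first exact: signed_unitsE.
apply/eqP; rewrite -subr_eq0; apply/eqP; apply: l1_eq0.
by move: xle; rewrite (l1_split _ j) xj1; lra.
Qed.

(** Twice such a vector has integral entries and l1 norm at most 2, so it is a sum
    of two signed unit vectors; this gives quadratically many possibilities. *)
Lemma l1_le1_half_integer (R : realType) k (x : 'cV[R]_k) :
    (forall j, `|x j 0| \in [:: 0; 2^-1; 1]) -> \sum_j `|x j 0| <= 1 ->
  x \in [seq 2^-1 *: (z + z') | z <- signed_units R k, z' <- signed_units R k].
Proof.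
move=> xh xle; suff [z [z' [zu zu' e]]] : exists z z',
    [/\ z \in signed_units R k, z' \in signed_units R k & 2 *: x = z + z'].
  apply/allpairsP; exists (z, z'); split=> //=.
  by rewrite -e scalerA mulVf ?scale1r ?pnatr_eq0.
have [->|] := eqVneq x 0.
  by exists 0, 0; rewrite scaler0 addr0 inE eqxx.
move=> /col_neq0P[j xj].
move: (xle); rewrite (l1_split _ j) => xle'.
have r2 i : (2 *: (x - x j 0 *: delta_mx j 0)) i 0 =
  2 * (x - x j 0 *: delta_mx j 0) i 0 by rewrite mxE.
have := xh j; rewrite !inE normr_eq0 (negPf xj) /= => /orP[/eqP xj2|/eqP xj1].
  exists ((2 * x j 0) *: delta_mx j 0), (2 *: (x - x j 0 *: delta_mx j 0)).
  split; first by rewrite signed_unitsE // normrM xj2 ger0_norm ?ler0n ?divff ?pnatr_eq0.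
    have sum2 : \sum_i `|(2 *: (x - x j 0 *: delta_mx j 0)) i 0| =
        2 * \sum_i `|(x - x j 0 *: delta_mx j 0) i 0|.
      rewrite mulr_sumr; apply: eq_bigr => i _.
      by rewrite r2 normrM ger0_norm.
    apply: l1_le1_integer => [i|]; last by rewrite sum2; lra.
    rewrite r2 normrM ger0_norm //.
    have [-> |nij] := eqVneq i j.
      by rewrite !mxE !eqxx mulr1 subrr normr0 mulr0 inE eqxx.
    rewrite !mxE (negPf nij) mulr0 subr0.
    have : `|x i 0| <= 2^-1.
      have : `|x i 0| + `|x j 0| <= \sum_j `|x j 0|.
        rewrite (bigD1 i) //= (bigD1 j) 1?eq_sym //= addrA lerDl sumr_ge0 //.
      by lra.
    have := xh i; rewrite !inE => /or3P[]/eqP -> h.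
    - by rewrite mulr0 eqxx.
    - by rewrite divff ?pnatr_eq0 ?eqxx ?orbT.
    - by exfalso; lra.
  by rewrite -scalerA -scalerDr addrC subrK.
exists (x j 0 *: delta_mx j 0), (x j 0 *: delta_mx j 0).
rewrite !signed_unitsE //; split=> //.
rewrite -mulr2n -scaler_nat; congr (_ *: _).
apply/eqP; rewrite -subr_eq0; apply/eqP; apply: l1_eq0.
by move: xle'; rewrite xj1; lra.
Qed.

Lemma minors_in_entry (R : realType) m (T : {set 'I_m}) (V : seq 'cV[R]_m) P :
  minors_in T V P -> forall v i, v \in V -> i \in T -> P `|v i 0|.
Proof.
move=> H v i vV iT; have := H 1%N (fun=> i) (fun=> v) (fun=> iT) (fun=> vV).
by rewrite /minor det_mx11 mxE.
Qed.

Lemma minors_in_sub (R : realType) m (T T' : {set 'I_m}) (V V' : seq 'cV[R]_m)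
    (P P' : R -> Prop) :
  T' \subset T -> {subset V' <= V} -> (forall x, P x -> P' x) ->
  minors_in T V P -> minors_in T' V' P'.
Proof.
move=> /subsetP TT VV PP H k f v fT vV; apply/PP/H => i; first exact: TT.
exact: VV.
Qed.

Lemma coords_minors_in (R : realType) m (T : {set 'I_m}) (U : seq 'cV[R]_m)
    k f b (P : R -> Prop) :
    @nonzero_minor R m T U k f b -> P 0 ->
    (forall (f' : 'I_k -> 'I_m) (v' : 'I_k -> 'cV[R]_m),
       (forall i, f' i \in T) -> (forall j, v' j \in U) -> P `|minor f' v'|) ->
  minors_in setT (map (coords f b) U) (fun x => P (x * `|minor f b|)).
Proof.
move=> [fT bU nz] P0 UP l g v _ vX.
have /choice[w wP] : forall j, exists w, w \in U /\ v j = coords f b w.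
  by move=> j; have /mapP[w] := vX j; exists w.
have -> : v = fun j => coords f b (w j) by apply: funext => j; have [] := wP j.
case: (pselect (injective g)) => [gI|/minor_not_inj ->]; last first.
  by rewrite normr0 mul0r.
have [|f' [v' [f'T v'U ->]]] := minor_coords nz fT bU (v := w) gI.
  by move=> j; have [] := wP j.
exact: UP.
Qed.

(** * Deleting a row *)

Definition agree (R : realType) m (T : {set 'I_m}) (v w : 'cV[R]_m) :=
  [forall i in T, v i 0 == w i 0].

Lemma agreeP (R : realType) m (T : {set 'I_m}) (v w : 'cV[R]_m) :
  reflect (forall i, i \in T -> v i 0 = w i 0) (agree T v w).
Proof.
by apply: (iffP forall_inP) => h i iT; apply/eqP; [exact: h | rewrite h].
Qed.

(** When [p |: T] separates [V], this is one representative of each class of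
    vectors that agree on [T]. Selecting by the least entry in row [p] makes the
    discarded vectors members of fibers. *)
Definition lowest (R : realType) m (T : {set 'I_m}) (p : 'I_m) (V : seq 'cV[R]_m) :=
  [seq v : 'cV[R]_m <- V | ~~ has (fun w : 'cV[R]_m => agree T v w && (w p 0 < v p 0)) V].

(** The vectors whose entry in row [p] is a free choice between [a] and [c], as far
    as [p] and the rows [T] can tell. *)
Definition fiber (R : realType) m (T : {set 'I_m}) (p : 'I_m) (V : seq 'cV[R]_m) (a c : R) :=
  [seq v : 'cV[R]_m <- V | (v p 0 == a) && has (fun w : 'cV[R]_m => agree T v w && (w p 0 == c)) V].

Section RowDeletion.
Variables (R : realType) (m : nat) (T : {set 'I_m}) (p : 'I_m).
Variable (V : seq 'cV[R]_m).

Hypothesis sepV : separates (p |: T) V.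

Lemma lowest_separates : separates T (lowest T p V).
Proof.
move=> v w; rewrite !mem_filter => /andP[/hasPn vlow vV] /andP[/hasPn wlow wV] e.
apply: sepV => // i; rewrite !inE => /predU1P[->|]; last exact: e.
have := vlow w wV; have := wlow v vV.
have -> : agree T v w by apply/agreeP.
have -> : agree T w v by apply/agreeP => j /e.
by rewrite -!leNgt => h1 h2; apply/eqP; rewrite eq_le h1 h2.
Qed.

Lemma fiber_separates a c : separates T (fiber T p V a c).
Proof.
move=> v w; rewrite !mem_filter.
move=> /andP[/andP[/eqP vp _] vV] /andP[/andP[/eqP wp _] wV] e.
apply: sepV => // i; rewrite !inE => /predU1P[->|]; last exact: e.
by rewrite vp wp.
Qed.

Lemma fiber_lift a c u y : u \in fiber T p V a c -> y \in [:: a; c] ->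
  exists2 w, w \in V & w p 0 = y /\ forall i, i \in T -> w i 0 = u i 0.
Proof.
rewrite mem_filter => /andP[/andP[/eqP up /hasP[w wV /andP[/agreeP uw /eqP wp]]] uV].
rewrite !inE => /orP[]/eqP ->; first by exists u.
by exists w => //; split => // i /uw.
Qed.

Hypothesis uniqV : uniq V.

Lemma size_row_deletion (pairs : seq (R * R)) :
    {in V &, forall v w : 'cV[R]_m, w p 0 < v p 0 -> (v p 0, w p 0) \in pairs} ->
  (size V <= size (lowest T p V) +
    \sum_(q <- pairs) size (fiber T p V q.1 q.2))%N.
Proof.
move=> Vpairs; set low := fun v : 'cV[R]_m =>
  ~~ has (fun w : 'cV[R]_m => agree T v w && (w p 0 < v p 0)) V.
rewrite -(count_predC low V) -!size_filter leq_add2l.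
have -> : (\sum_(q <- pairs) size (fiber T p V q.1 q.2))%N =
    size (flatten [seq fiber T p V q.1 q.2 | q <- pairs]).
  by rewrite size_flatten /shape sumnE !big_map.
apply: uniq_leq_size; first exact: filter_uniq.
move=> v; rewrite mem_filter /= negbK => /andP[/hasP[w wV /andP[vw lt]] vV].
apply/flattenP; exists (fiber T p V (v p 0) (w p 0)).
  apply/mapP; exists (v p 0, w p 0) => //; exact: Vpairs.
by rewrite mem_filter vV eqxx andbT; apply/hasP; exists w; rewrite // vw eqxx.
Qed.

End RowDeletion.

Lemma fiber_uniq (R : realType) m (T : {set 'I_m}) (p : 'I_m) (V : seq 'cV[R]_m) (a c : R) :
  uniq V -> uniq (fiber T p V a c).
Proof. exact: filter_uniq. Qed.

Lemma fiber_sub (R : realType) m (T : {set 'I_m}) (p : 'I_m) (V : seq 'cV[R]_m) (a c : R) :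
  {subset fiber T p V a c <= V}.
Proof. by move=> v; rewrite mem_filter => /andP[]. Qed.

Lemma lowest_sub (R : realType) m (T : {set 'I_m}) (p : 'I_m) (V : seq 'cV[R]_m) :
  {subset lowest T p V <= V}.
Proof. by move=> v; rewrite mem_filter => /andP[]. Qed.

Lemma size_le1 (X : eqType) (s : seq X) :
  uniq s -> {in s &, forall x y, x = y} -> (size s <= 1)%N.
Proof.
case: s => [|x [|y s]] // /andP[/negP xs _] /(_ x y); rewrite !inE !eqxx orbT.
by move=> /(_ isT isT) e; case: xs; rewrite e inE eqxx.
Qed.

(** * Totally unimodular families *)

(** A nonzero minor of maximal order is 1 up to sign, so the coordinate vectors are
    integral and [free_row_l1] bounds their l1 norm by 1: each is zero or a signed
    unit vector. *)
Lemma unimodular_fiber_adjacent (R : realType) m (T : {set 'I_m}) (p : 'I_m)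
    (V : seq 'cV[R]_m) (a c : R) :
    uniq V -> separates (p |: T) V ->
    minors_in (p |: T) V (fun x => x \in [:: 0; 1]) -> a - c = 1 ->
  (size (fiber T p V a c) <= (2 * m).+1)%N.
Proof.
move=> uV sepV V01 ac; set U := fiber T p V a c.
have U01 : minors_in T U (fun x => x \in [:: 0; 1]).
  by apply: minors_in_sub V01; rewrite ?subsetUr //; exact: fiber_sub.
have [k [km [f [b fb]] max]] := maximal_minor_order T U.
have detB : `|minor f b| = 1.
  have [fT bU nz] := fb.
  by have := U01 _ _ _ fT bU; rewrite !inE normr_eq0 (negPf nz) => /eqP.
have inj := coords_inj fb max (@fiber_separates _ _ _ _ _ sepV a c).
have X01 := coords_minors_in fb (mem_head _ _) (U01 k).
rewrite -(size_map (coords f b)); apply: (@leq_trans (2 * k).+1); last first.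
  by rewrite ltnS leq_mul2l.
rewrite -(@size_signed_units R); apply: uniq_leq_size.
  by rewrite map_inj_in_uniq //; exact: fiber_uniq.
move=> x xX; apply: l1_le1_integer.
  by move=> j; have := minors_in_entry X01 xX (in_setT j); rewrite detB mulr1.
move/mapP: xX => [d dU ->].
have Vle : minors_in (p |: T) V (fun x => x <= 1).
  by apply: minors_in_sub V01 => // y; rewrite !inE => /orP[]/eqP ->.
have lift u y : u \in U -> y \in [:: a; c] -> exists2 w, w \in V &
    w p 0 = y /\ forall i, i \in T -> w i 0 = u i 0 by exact: fiber_lift.
by have := free_row_l1 Vle lift ac fb dU; rewrite detB; lra.
Qed.

(** If [u] and [w] agree in row [i] with the common entry [s], and have entries 1
    and -1 in row [p], then the minor on these two rows is [-2 * s]. So [s = 0],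
    and the only possible member of the fiber vanishes on [T]. *)
Lemma unimodular_fiber_opposite (R : realType) m (T : {set 'I_m}) (p : 'I_m)
    (V : seq 'cV[R]_m) :
    uniq V -> separates (p |: T) V ->
    minors_in (p |: T) V (fun x => x \in [:: 0; 1]) ->
  (size (fiber T p V 1 (-1)) <= 1)%N.
Proof.
move=> uV sepV V01; apply: size_le1; first exact: fiber_uniq.
suff U0 : forall u i, u \in fiber T p V 1 (-1) -> i \in T -> u i 0 = 0.
  by move=> u w uU wU; apply: (fiber_separates sepV uU wU) => i iT; rewrite !U0.
move=> u i uU iT; apply/eqP/negPn/negP => ui.
have uV' := fiber_sub uU.
have [w wV [wp wT]] := fiber_lift uU (mem_last 1 [:: -1]).
have up : u p 0 = 1 by move: uU; rewrite mem_filter => /andP[/andP[/eqP]].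
have mE : minor (fun _ : 'I_1 => i) (fun _ : 'I_1 => u) = u i 0.
  by rewrite /minor det_mx11 mxE.
have iE := minors_in_entry V01 uV' (setU1r _ iT).
have := V01 _ (snoc (fun _ : 'I_1 => i) p) (snoc (fun _ : 'I_1 => u) w).
have nz : minor (fun _ : 'I_1 => i) (fun _ : 'I_1 => u) != 0 by rewrite mE.
rewrite minor_snoc_coords // mE.
have -> : coords (fun _ : 'I_1 => i) (fun _ : 'I_1 => u) w = delta_mx 0 0.
  rewrite -(coords_basis nz) /coords; congr (_ *m _).
  by apply/colP => j; rewrite !mxE wT.
rewrite big_ord1 wp up !mxE !eqxx => /(_ _ _)H.
have : `|u i 0 * (-1 - 1 * 1)| \in [:: 0; 1 : R].
  apply: H.
    apply: (@snoc_all _ _ (fun _ : 'I_1 => i) p (fun u => u \in p |: T)).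
      by move=> _; exact: setU1r.
    exact: setU11.
  exact: (@snoc_all _ _ (fun _ : 'I_1 => u) w (fun u => u \in V)).
move: iE; rewrite normrM !inE normr_eq0 (negPf ui) /= => /eqP ->.
rewrite !mul1r -opprD normrN ger0_norm ?addr_ge0 //.
by move=> /orP[]/eqP; lra.
Qed.

Definition heller_bound (m : nat) : nat := (1 + (4 * m + 3) * m)%N.

(** Heller's theorem, up to the constant. Deleting row [p] loses only vectors
    whose entry in row [p] is the larger of two values in {-1, 0, 1}. *)
Lemma heller (R : realType) m (T : {set 'I_m}) (V : seq 'cV[R]_m) :
    uniq V -> separates T V -> minors_in T V (fun x => x \in [:: 0; 1]) ->
  (size V <= heller_bound m)%N.
Proof.
move=> uV sepV V01; apply: (@leq_trans (1 + (4 * m + 3) * #|T|)); last first.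
  rewrite leq_add2l leq_mul2l; apply/orP; right.
  by apply: leq_trans (max_card T) _; rewrite card_ord.
have [n] := ubnP #|T|; elim: n T V uV sepV V01 => // n IH T V uV sepV V01.
rewrite ltnS; have [T0|[p pT]] := set_0Vmem T.
  move=> _; rewrite T0 cards0 muln0 addn0; apply: size_le1 => // v w vV wV.
  by apply: sepV => // i; rewrite T0 in_set0.
rewrite (cardsD1 p T) pT /= add1n => cT.
rewrite -(setD1K pT) in sepV V01; set T' := T :\ p in sepV V01 cT *.
have Vp v : v \in V -> v p 0 \in [:: -1; 0; 1].
  move=> vV; have := minors_in_entry V01 vV (setU11 _ _).
  rewrite !inE normr_eq0 => /orP[/eqP ->|]; first by rewrite eqxx orbT.
  by rewrite eqr_norml ler01 andbT => /orP[]/eqP ->; rewrite eqxx ?orbT.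
(* The pairs of values that two vectors differing only in row [p] can take. *)
have := @size_row_deletion _ _ T' p V uV [:: (1, 0); (0, -1); (1, -1)].
rewrite !big_cons big_nil addn0 => del; apply: leq_trans (del _) _.
  move=> v w /Vp + /Vp; rewrite !inE.
  by move=> /or3P[]/eqP -> /or3P[]/eqP -> //=; rewrite ?eqxx ?orbT // => h; exfalso; lra.
have low := IH T' (lowest T' p V) (filter_uniq _ uV) (lowest_separates sepV).
have f1 : (size (fiber T' p V 1 0) <= (2 * m).+1)%N.
  by apply: unimodular_fiber_adjacent => //; rewrite subr0.
have f2 : (size (fiber T' p V 0 (-1)) <= (2 * m).+1)%N.
  by apply: unimodular_fiber_adjacent => //; rewrite sub0r opprK.
have f3 := unimodular_fiber_opposite uV sepV V01.
have {}low : (size (lowest T' p V) <= 1 + (4 * m + 3) * #|T'|)%N.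
  apply: low => //; apply: minors_in_sub V01; rewrite ?subsetUr //.
  exact: lowest_sub.
apply: leq_trans (leq_add low (leq_add f1 (leq_add f2 f3))) _.
by rewrite /= add1n mulnS; lia.
Qed.

(** * Families with half-integral minors *)

Lemma half_modular_fiber (R : realType) m (T : {set 'I_m}) (p : 'I_m)
    (V : seq 'cV[R]_m) (a c : R) :
    uniq V -> separates (p |: T) V ->
    minors_in (p |: T) V (fun x => x \in [:: 0; 2^-1; 1]) -> a - c = 1 ->
  (size (fiber T p V a c) <= (2 * m).+1 ^ 2 + heller_bound m)%N.
Proof.
move=> uV sepV Vh ac; set U := fiber T p V a c.
have Uh : minors_in T U (fun x => x \in [:: 0; 2^-1; 1]).
  by apply: minors_in_sub Vh; rewrite ?subsetUr //; exact: fiber_sub.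
have [k [km [f1 [b1 fb1]] max]] := maximal_minor_order T U.
have inj f b fb := @coords_inj R m T U k f b fb max (@fiber_separates _ _ _ _ _ sepV a c).
have uX f b : @nonzero_minor R m T U k f b -> uniq (map (coords f b) U).
  by move=> fb; rewrite map_inj_in_uniq; [exact: fiber_uniq | exact: inj].
have [[f [b [fb detB]]]|no1] := pselect (exists f, exists b,
    @nonzero_minor R m T U k f b /\ `|minor f b| = 1).
  have Xh := coords_minors_in fb (mem_head _ _) (Uh k).
  rewrite -(size_map (coords f b)); apply: leq_trans (leq_addr _ _).
  apply: (@leq_trans ((2 * k).+1 ^ 2)); last first.
    by rewrite leq_exp2r // ltnS leq_mul2l.
  rewrite -mulnn -(@size_signed_units R) -(size_allpairs
    (fun z z' : 'cV[R]_k => 2^-1 *: (z + z'))).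
  apply: uniq_leq_size; first exact: uX.
  move=> x xX; apply: l1_le1_half_integer.
    by move=> j; have := minors_in_entry Xh xX (in_setT j); rewrite detB mulr1.
  move/mapP: xX => [d dU ->].
  have Vle : minors_in (p |: T) V (fun x => x <= 1).
    by apply: minors_in_sub Vh => // y; rewrite !inE => /or3P[]/eqP ->; lra.
  have lift u y : u \in U -> y \in [:: a; c] -> exists2 w, w \in V &
      w p 0 = y /\ forall i, i \in T -> w i 0 = u i 0 by exact: fiber_lift.
  by have := free_row_l1 Vle lift ac fb dU; rewrite detB; lra.
(* Every nonzero minor of maximal order is now 1/2, so dividing by one of them
   gives minors of coordinate vectors in {0, 1}. *)
have half f b : @nonzero_minor R m T U k f b -> `|minor f b| = 2^-1 :> R.
  move=> fb; have [fT bU nz] := fb.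
  have := Uh k f b fT bU; rewrite !inE normr_eq0 (negPf nz) /= => /orP[]/eqP //.
  by move=> e; case: no1; exists f, b.
have X01 := @coords_minors_in _ _ T U k f1 b1
  (fun x => x \in [:: 0; 2^-1]) fb1 (mem_head _ _).
rewrite -(size_map (coords f1 b1)); apply: leq_trans (leq_addl _ _).
apply: (@leq_trans (heller_bound k)).
  apply: (@heller R _ setT); first exact: uX.
    by move=> v w _ _ e; apply/colP => i; apply: e.
  apply: minors_in_sub (X01 _) => // [x|f v fT vU].
    rewrite half // !inE mulf_eq0 (_ : (2^-1 == 0 :> R) = false); last first.
      by apply/negbTE; rewrite invr_eq0 pnatr_eq0.
    rewrite orbF => /orP[->//|/eqP h]; apply/orP; right; apply/eqP; lra.
  have [->|nz] := eqVneq (minor f v) 0; first by rewrite normr0 mem_head.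
  by rewrite half // !inE eqxx orbT.
by rewrite leq_add2l leq_mul // leq_add2r leq_mul2l.
Qed.

(** Induction on [#|Q|]; when no row of [Q] is left, the family is totally
    unimodular on [T]. *)
Lemma half_rows (R : realType) m (T Q : {set 'I_m}) (V : seq 'cV[R]_m) :
    uniq V -> separates (Q :|: T) V ->
    minors_in T V (fun x => x \in [:: 0; 1]) ->
    minors_in (Q :|: T) V (fun x => x \in [:: 0; 2^-1; 1]) ->
    (forall v i, v \in V -> i \in Q -> v i 0 \in [:: 2^-1; - 2^-1]) ->
  (size V <= heller_bound m + #|Q| * ((2 * m).+1 ^ 2 + heller_bound m))%N.
Proof.
have [n] := ubnP #|Q|; elim: n Q V => // n IH Q V + uV sepV V01 Vh VQ.
rewrite ltnS; have [Q0|[p pQ]] := set_0Vmem Q.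
  move=> _; apply: leq_trans (leq_addr _ _); apply: (heller uV _ V01).
  by rewrite Q0 set0U in sepV.
have QE : Q :|: T = p |: (Q :\ p :|: T) by rewrite setUA setD1K.
rewrite (cardsD1 p Q) pQ /= add1n => cQ; rewrite QE in sepV Vh.
have del := @size_row_deletion _ _ (Q :\ p :|: T) p V uV [:: (2^-1, - 2^-1)].
rewrite big_seq1 /= in del; apply: leq_trans (del _) _.
  move=> v w /VQ/(_ pQ) + /VQ/(_ pQ); rewrite !inE.
  by move=> /orP[]/eqP -> /orP[]/eqP -> //=; rewrite ?eqxx ?orbT // => h; exfalso; clear -h; lra.
have fib : (size (fiber (Q :\ p :|: T) p V 2^-1 (- 2^-1)) <=
    (2 * m).+1 ^ 2 + heller_bound m)%N.
  by apply: half_modular_fiber => //; clear; lra.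
have low : (size (lowest (Q :\ p :|: T) p V) <= heller_bound m +
    #|Q :\ p| * ((2 * m).+1 ^ 2 + heller_bound m))%N.
  apply: IH => //.
  - exact: filter_uniq.
  - exact: lowest_separates.
  - by apply: minors_in_sub V01 => //; exact: lowest_sub.
  - by apply: minors_in_sub Vh; rewrite ?subsetUr //; exact: lowest_sub.
  - by move=> v i /lowest_sub vV; rewrite in_setD1 => /andP[_]; exact: VQ.
by apply: leq_trans (leq_add low fib) _; rewrite mulSn -addnA leq_add2l addnC.
Qed.

(** * Integrality of minors of shifted matrices *)

Lemma det_int (R : realType) k (N : 'M[R]_k) :
  (forall i j, N i j \is a Num.int) -> \det N \is a Num.int.
Proof.
move=> Nint; apply: rpred_sum => s _; rewrite rpredM //.
  by rewrite rpredX // rpredN rpred1.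
by apply: rpred_prod.
Qed.

(** The matrix is the sum of an integral matrix and a column of half-integers
    repeated [k] times. It is therefore the Schur complement of the entry 2 in an
    integral matrix of order [k + 1]. *)
Lemma det_half_int (R : realType) k (N : 'M[R]_k) (h : 'I_k -> R) :
    (forall i, 2 * h i \is a Num.int) -> (forall i j, N i j - h i \is a Num.int) ->
  2 * \det N \is a Num.int.
Proof.
move=> h2 Nh; pose n : 'M[R]_k := \matrix_(i, j) (N i j - h i).
pose b : 'cV[R]_k := \col_i (2 * h i).
have E := det_schur_left n b (const_mx (- 2^-1)) (2%:M : 'M_1).
have N1 : n - b *m const_mx (- 2^-1) = N.
  by apply/matrixP => i j; rewrite !mxE big_ord1 !mxE; lra.
rewrite N1 det_scalar1 mulrC in E; rewrite -E; apply: det_int => i j.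
rewrite !mxE; case: (split i) => i'; rewrite !mxE; case: (split j) => j'.
- by rewrite mxE.
- by rewrite mxE.
- rewrite mxE big_ord1 !mxE !ord1 eqxx mulr1n mulrN divff ?pnatr_eq0 //.
  by rewrite rpredN rpred1.
- by rewrite mxE !ord1 eqxx mulr1n rpred_nat.
Qed.

Lemma int_norm_lt2 (R : realType) (x : R) :
  x \is a Num.int -> `|x| < 2 -> `|x| \in [:: 0; 1].
Proof.
move=> /natr_norm_int/natrP[n ->]; rewrite ltr_nat !inE !pnatr_eq0 pnatr_eq1.
by case: n => [|[]].
Qed.

Lemma half_int_norm_le1 (R : realType) (x : R) :
  2 * x \is a Num.int -> `|x| <= 1 -> `|x| \in [:: 0; 2^-1; 1].
Proof.
move=> /natr_norm_int/natrP[n]; rewrite normrM ger0_norm // => e xle.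
have : (n <= 2)%N by rewrite -(@ler_nat R) -e; lra.
rewrite !inE; case: n e => [|[|[|]]] // e _.
- by apply/orP; left; apply/eqP; lra.
- by apply/orP; right; apply/orP; left; apply/eqP; lra.
- by apply/orP; right; apply/orP; right; apply/eqP; lra.
Qed.

(** * Columns with a common large entry *)

(** Pivoting on the common entry [c] of row [p] in the column [v0] subtracts [v0]
    from the other columns. So a minor of the differences is a minor of [V]
    divided by [c], an integer of absolute value at most [1 / `|c| < 2]. *)
Lemma size_constant_row (R : realType) m (p : 'I_m) (c : R)
    (V : seq 'cV[R]_m) :
    uniq V -> minors_in setT V (fun x => x <= 1) ->
    (forall v, v \in V -> v p 0 = c) -> 2^-1 < `|c| ->
    (forall v w i, v \in V -> w \in V -> v i 0 - w i 0 \is a Num.int) ->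
  (size V <= heller_bound m)%N.
Proof.
move=> uV Vle Vp c2 Vint; case: V => // v0 V' in uV Vle Vp Vint *.
set V := v0 :: V' in uV Vle Vp Vint *.
have v0V : v0 \in V by rewrite mem_head.
rewrite -(size_map (fun v => v - v0)); apply: (@heller _ _ (~: [set p])).
- by rewrite map_inj_uniq //; exact: addIr.
- move=> _ _ /mapP[v vV ->] /mapP[w wV ->] e; apply/colP => i.
  have [->|ip] := eqVneq i p; first by rewrite !mxE !Vp.
  by apply: e; rewrite !inE.
move=> k f w fT wW.
have /choice[v vP] : forall j, exists v, v \in V /\ w j = v - v0.
  by move=> j; have /mapP[v] := wW j; exists v.
have wint : minor f w \is a Num.int.
  apply: det_int => i j; rewrite mxE; have [vV ->] := vP j.
  by rewrite !mxE; exact: Vint.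
apply: int_norm_lt2 => //.
have : `|minor (snoc f p) (snoc v v0)| <= 1.
  apply: Vle => [i|]; first by rewrite inE.
  by apply: (@snoc_all _ _ v v0 (fun u => u \in V)) => // j; have [] := vP j.
rewrite /minor minor_mx_snoc (_ : \row_j v j p 0 = (v0 p 0)%:M *m const_mx 1).
  rewrite det_schur_left det_scalar1 normrM Vp //.
  rewrite (_ : _ - _ = minor_mx f w); first by move=> h; nra.
  apply/matrixP => i j; rewrite !mxE big_ord1 !mxE mulr1.
  by have [_ ->] := vP j; rewrite !mxE.
apply/rowP => j; rewrite !mxE big_ord1 !mxE eqxx mulr1n mulr1 !Vp //.
by have [] := vP j.
Qed.

(** * Shifted totally 1-submodular matrices *)

Lemma injective_sortable m k (f : 'I_k -> 'I_m) : injective f ->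
  exists s : 'S_k, increasing_sel [ffun i => f (s i)].
Proof.
move=> fI; pose t := [tuple f i | i < k].
pose le := relpre (@nat_of_ord m) leq.
have : perm_eq (sort le t) t by rewrite perm_sort.
move=> /tuple_permP[s sE]; exists s; apply/forallP => i; apply/forallP => j.
apply/implyP => ij; rewrite !ffunE.
have st : sorted ltn (map (@nat_of_ord m) (sort le t)).
  rewrite ltn_sorted_uniq_leq map_inj_uniq ?sort_uniq; last exact: val_inj.
  rewrite map_inj_uniq ?enum_uniq //= sorted_map.
  by apply: sort_sorted => x y; exact: leq_total.
have nthE (l : 'I_k) : nth 0%N (map (@nat_of_ord m) (sort le t)) l = f (s l).
  rewrite sE -map_comp (nth_map l) ?size_enum_ord // nth_ord_enum /=.
  by rewrite tnth_mktuple.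
rewrite -!nthE; apply: (sorted_ltn_nth ltn_trans) => //;
  by rewrite inE size_map size_sort size_tuple.
Qed.

Lemma totally_1_submodular_minors (R : realType) m n (M : 'M[R]_(m, n)) :
  totally_1_submodular M ->
  minors_in setT [seq col j M | j <- enum 'I_n] (fun x => x <= 1).
Proof.
move=> Mle k f v _ vM.
have /choice[g gE] : forall j, exists l, v j = col l M.
  by move=> j; have /mapP[l] := vM j; exists l.
have mE : minor f v = \det (mxsub f g M).
  by congr (\det _); apply/matrixP => i j; rewrite !mxE gE mxE.
case: (pselect (injective f)) => [fI|/minor_not_inj ->]; last by rewrite normr0 ler01.
case: (pselect (injective g)) => [gI|/injectiveP/injectivePn[i [j nij gij]]]; last first.
  rewrite mE -det_tr (determinant_alternate nij) ?normr0 ?ler01 // => l.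
  by rewrite !mxE gij.
have [s fs] := injective_sortable fI; have [r gr] := injective_sortable gI.
have [k0|kpos] := posnP k.
  by rewrite /minor; move: (minor_mx f v); rewrite k0 => N; rewrite det_mx00 normr1.
have kmn : (1 <= k < (minn m n).+1)%N.
  rewrite kpos ltnS leq_min -{1}[k]card_ord -{1}[m]card_ord (leq_card f) //=.
  by rewrite -{1}[k]card_ord -{1}[n]card_ord (leq_card g).
have -> : `|minor f v| = `|\det (mxsub [ffun i => f (s i)] [ffun i => g (r i)] M)|.
  rewrite mE.
  have -> : mxsub [ffun i => f (s i)] [ffun i => g (r i)] M =
      row_perm s (col_perm r (mxsub f g M)).
    by apply/matrixP => i j; rewrite !mxE !ffunE.
  rewrite row_permE col_permE !det_mulmx !det_perm !normrM !normr_sign.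
  by rewrite mul1r mulr1.
apply: le_trans Mle; rewrite /totally_1_submodular.
apply: le_trans (le_bigmax_seq _ _ _ _ _ _); last 2 first.
- by rewrite mem_index_iota; exact: kmn.
- by [].
rewrite /Delta; apply: le_trans (le_bigmax_cond _ _ fs).
exact: (le_bigmax_cond _ (fun g : {ffun _} => `|\det (mxsub _ g M)|) gr).
Qed.

Lemma shifted_heller_admissible_cubic (R : realType) m n : (0 < m)%N ->
  shifted_heller_admissible R m n -> (n <= 33 * m ^ 3)%N.
Proof.
move=> m0 [t [A [_ t01 A01 Ainj /totally_1_submodular_minors]]].
set V := [seq col j _ | j <- _] => Vle.
have uV : uniq V.
  rewrite map_inj_in_uniq ?enum_uniq // => j l _ _ /colP e; apply: Ainj.
  by apply/colP => i; have := e i; rewrite !mxE => /addrI.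
have VA v i : v \in V -> exists2 a, v i 0 = t i 0 + a & a \in [:: -1; 0; 1].
  by move=> /mapP[j _ ->]; exists (A i j); rewrite ?mxE ?A01.
have Aint a : a \in [:: -1; 0; 1 : R] -> a \is a Num.int.
  by rewrite !inE => /or3P[]/eqP ->; rewrite ?rpredN ?rpred0 ?rpred1.
have Vint v i : v \in V -> v i 0 - t i 0 \is a Num.int.
  by move=> /(VA _ i)[a -> /Aint]; rewrite addrC addKr.
have V2 v i : v \in V -> t i 0 != 0 -> v i 0 \in [:: t i 0; t i 0 - 1].
  move=> vV ti; have [a e a01] := VA v i vV.
  have /andP[ti0 ti1] := t01 i.
  have := minors_in_entry Vle vV (in_setT i); rewrite e => le1.
  move: a01; rewrite !inE => /or3P[]/eqP ae; rewrite ae ?addr0 ?eqxx ?orbT //.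
  have : 0 < t i 0 by rewrite lt_def ti.
  by move: le1; rewrite ae ger0_norm; lra.
pose S := [set i | t i 0 == 0]; pose Q := [set i | t i 0 == 2^-1].
pose P := ~: (Q :|: S).
(* Of the two possible entries of row [i], the one of larger absolute value. *)
pose big i := if 2^-1 < t i 0 then t i 0 else t i 0 - 1.
pose J i := [seq v : 'cV[R]_m <- V | v i 0 == big i].
pose V' := [seq v : 'cV[R]_m <- V | [forall i in P, v i 0 != big i]].
have V'V : {subset V' <= V} by move=> v; rewrite mem_filter => /andP[].
have sizeJ i : i \in P -> (size (J i) <= heller_bound m)%N.
  rewrite !inE => /norP[tQ tS].
  have JV : {subset J i <= V} by move=> v; rewrite mem_filter => /andP[].
  apply: (@size_constant_row _ _ i (big i)); first exact: filter_uniq.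
  - by apply: minors_in_sub Vle; rewrite ?subsetT.
  - by move=> v; rewrite mem_filter => /andP[/eqP].
  - have /andP[ti0 ti1] := t01 i; rewrite /big; case: ifP => [h|/negbT].
      by rewrite ger0_norm.
    rewrite -leNgt => h; have h' : t i 0 < 2^-1 by rewrite lt_neqAle tQ.
    by rewrite ler0_norm; lra.
  - move=> v w l /JV vV /JV wV.
    rewrite (_ : _ - _ = (v l 0 - t l 0) - (w l 0 - t l 0)); last by ring.
    by rewrite rpredB ?Vint.
have sizeV' : (size V' <= heller_bound m +
    #|Q| * ((2 * m).+1 ^ 2 + heller_bound m))%N.
  apply: (@half_rows _ _ S).
  - exact: filter_uniq.
  - move=> v w; rewrite !mem_filter => /andP[/forall_inP vP vV] /andP[/forall_inP wP wV].
    move=> e; apply/colP => i; have [iQS|] := boolP (i \in Q :|: S); first exact: e.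
    rewrite -in_setC => iP; have /norP[_ ti] : ~~ ((t i 0 == 2^-1) || (t i 0 == 0)).
      by move: iP; rewrite !inE.
    have := V2 v i vV ti; have := V2 w i wV ti; have := vP i iP; have := wP i iP.
    rewrite !inE /big; case: ifP => _ /negPf-> /negPf-> ; rewrite ?orbF /=.
      by move=> /eqP -> /eqP ->.
    by move=> /eqP -> /eqP ->.
  - move=> k f v fS vV; apply: int_norm_lt2.
      apply: det_int => i j; rewrite mxE; have := fS i; rewrite inE => /eqP t0.
      by have := Vint _ (f i) (V'V _ (vV j)); rewrite t0 subr0.
    by apply: (@le_lt_trans _ _ 1); [apply: Vle => [i|j]; [exact: in_setT | exact: V'V] | lra].
  - move=> k f v fS vV; apply: half_int_norm_le1; last first.
      by apply: Vle => [i|j]; [exact: in_setT | exact: V'V].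
    apply: (@det_half_int _ _ _ (fun i => t (f i) 0)) => [i|i j].
      have := fS i; rewrite !inE => /orP[]/eqP ->; last by rewrite mulr0 rpred0.
      by rewrite divff ?pnatr_eq0 // rpred1.
    by rewrite mxE; apply: Vint; exact: V'V.
  - move=> v i /V'V vV; rewrite inE => /eqP ti.
    have := V2 v i vV; rewrite ti invr_eq0 pnatr_eq0 => /(_ isT).
    by rewrite !inE (_ : 2^-1 - 1 = - 2^-1 :> R) //; lra.
have : (size V <= size (V' ++ flatten [seq J i | i <- enum P]))%N.
  apply: uniq_leq_size => // v vV; rewrite mem_cat.
  have [vV'|] := boolP (v \in V') => //=.
  rewrite mem_filter vV andbT negb_forall_in => /exists_inP[i iP].
  rewrite negbK => vi; apply/flattenP; exists (J i).
    by apply: map_f; rewrite mem_enum.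
  by rewrite mem_filter vi.
rewrite size_map size_enum_ord size_cat size_flatten /shape sumnE !big_map.
rewrite big_enum /= => /leq_trans; apply.
have sumJ : (\sum_(i in P) size (J i) <= m * heller_bound m)%N.
  apply: (@leq_trans (\sum_(i in P) heller_bound m)); first exact: leq_sum.
  rewrite sum_nat_const leq_mul2r; apply/orP; right.
  by apply: leq_trans (max_card _) _; rewrite card_ord.
have Qm : (#|Q| <= m)%N by apply: leq_trans (max_card _) _; rewrite card_ord.
apply: leq_trans (leq_add sizeV' sumJ) _.
apply: (@leq_trans (heller_bound m + m * ((2 * m).+1 ^ 2 + heller_bound m)
  + m * heller_bound m)).
  by rewrite leq_add2r leq_add2l leq_mul2r Qm orbT.
rewrite /heller_bound; clear -m0; rewrite -!mulnn !expnS expn0 muln1; nia.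
Qed.

Theorem theorem1 (R : realType) :
  exists C : R, 0 < C /\
    forall m : nat, (1 <= m)%N ->
      (shifted_heller R m)%:R <= C * m%:R ^+ 3.
Proof.
exists 33%:R; split; first by rewrite ltr0n.
move=> m m0; have [adm _] := shifted_hellerP R m0.
rewrite -natrX -natrM ler_nat.
exact: shifted_heller_admissible_cubic adm.
Qed.
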